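(* Let $M$ be a nonnegative $p \times q$ real matrix with $\mathrm{rank}(M) = 3$. Then the psd rank of $M$ is at most $4\left\lceil \frac{\min\{p,q\}}{6} \right\rceil$. In particular, the psd rank of a (convex) polygon with $v$ vertices is at most $4\left\lceil \frac{v}{6}\right\rceil$.
   Context: Let $\mathcal{S}_+^k$ be the cone of real symmetric positive semidefinite $k\times k$ matrices. The psd rank of an entrywise nonnegative $p\times q$ matrix $M$ is the smallest $k$ such that there are $A_1,\dots,A_p,B_1,\dots,B_q\in\mathcal{S}_+^k$ with $M_{ij}=\mathrm{Trace}(A_iB_j)$ for all $i,j$. The psd rank of a full-dimensional polytope $P\subset\mathbb{R}^n$ with vertices $p_1,\dots,p_v$ and facet-defining inequalities $d_j - c_j^T x \ge 0$ ($j=1,\dots,f$) is the psd rank of its slack matrix, the $v\times f$ nonnegative matrix with $(i,j)$ entry $d_j - c_j^T p_i$. (It is known that this equals the smallest $k$ such that $P$ is a linear image of the intersection of $\mathcal{S}_+^k$ with an affine subspace of the space of symmetric $k\times k$ matrices.) *)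

(* Defs.v *)
From HB Require Import structures.
From mathcomp Require Import all_boot all_order all_algebra.
From mathcomp Require Import boolp classical_sets functions cardinality reals.
From mathcomp Require Import interval_inference convex.

Set Implicit Arguments.
Unset Strict Implicit.
Unset Printing Implicit Defensive.

Import Order.TTheory GRing.Theory Num.Theory.

Local Open Scope classical_set_scope.
Local Open Scope ring_scope.

Section PsdRank.
Variable R : realType.

Definition nonneg_mx p q (M : 'M[R]_(p, q)) : Prop := forall i j, 0 <= M i j.

Definition psd_mx k (A : 'M[R]_k) : Prop :=
  A^T = A /\ forall x : 'cV[R]_k, 0 <= (x^T *m A *m x) 0 0.

Definition has_psd_factorization p q (M : 'M[R]_(p, q)) (k : nat) : Prop :=
  exists (A : 'I_p -> 'M[R]_k) (B : 'I_q -> 'M[R]_k),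
    [/\ forall i, psd_mx (A i), forall j, psd_mx (B j)
      & forall i j, M i j = \tr (A i *m B j)].

(* Total function: the default 0 is only reached by matrices without any psd
   factorization, hence never by a nonnegative one (see [psd_rankP]). *)
Definition psd_rank p q (M : 'M[R]_(p, q)) : nat :=
  if pselect (exists k, `[< has_psd_factorization M k >]) is left h
  then ex_minn h else 0%N.

Lemma psd_diag_mx k (d : 'rV[R]_k) :
  (forall i, 0 <= d 0 i) -> psd_mx (diag_mx d).
Proof.
move=> d0; split; first exact: tr_diag_mx.
move=> x; rewrite mxE; apply: sumr_ge0 => i _.
by rewrite mul_mx_diag !mxE mulrAC mulr_ge0// -expr2 sqr_ge0.
Qed.

Lemma nonneg_has_psd_factorization p q (M : 'M[R]_(p, q)) :
  nonneg_mx M -> has_psd_factorization M q.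
Proof.
move=> M0; exists (fun i => diag_mx (row i M)).
exists (fun j => diag_mx (delta_mx 0 j)); split => [i|j|i j].
- by apply: psd_diag_mx => j; rewrite mxE.
- by apply: psd_diag_mx => i; rewrite mxE ler0n.
- rewrite mulmx_diag mxtrace_diag (bigD1 j)//= big1 ?addr0 ?mxE.
    by rewrite !eqxx mulr1.
  by move=> l /negbTE lj; rewrite !mxE lj mulr0.
Qed.

Lemma psd_rankP p q (M : 'M[R]_(p, q)) : nonneg_mx M ->
  has_psd_factorization M (psd_rank M) /\
  forall k, has_psd_factorization M k -> (psd_rank M <= k)%N.
Proof.
move=> M0; rewrite /psd_rank; case: pselect => [h|[]].
  case: ex_minnP => k /asboolP kM kmin; split => // l lM.
  by apply: kmin; apply/asboolP.
by exists q; apply/asboolP; exact: nonneg_has_psd_factorization.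
Qed.

End PsdRank.

Section Polytopes.
Variables (R : realType) (n : nat).
Implicit Types (P F : set 'cV[R]_n) (c x : 'cV[R]_n) (d : R).

Definition convex_hull (X : set 'cV[R]_n) : set 'cV[R]_n :=
  smallest (@convex_set R 'cV[R]_n) X.

Definition is_polytope P : Prop :=
  exists s : seq 'cV[R]_n, P = convex_hull [set` s].

Definition affinely_independent k (x : 'I_k.+1 -> 'cV[R]_n) : Prop :=
  row_free (\matrix_(i < k) (x (lift ord0 i) - x ord0)^T).

(* [k] is the dimension of the affine hull of [F]; no [k] qualifies if [F] is
   empty. *)
Definition has_affine_dim F (k : nat) : Prop :=
  (exists x : 'I_k.+1 -> 'cV[R]_n,
      (forall i, F (x i)) /\ affinely_independent x) /\
  ~ (exists x : 'I_k.+2 -> 'cV[R]_n,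
      (forall i, F (x i)) /\ affinely_independent x).

Definition slack c d x : R := d - (c^T *m x) 0 0.

Definition valid_ineq P c d : Prop := forall x, P x -> 0 <= slack c d x.

Definition face_of P c d : set 'cV[R]_n := [set x | P x /\ slack c d x = 0].

Definition is_face P F : Prop :=
  exists c d, valid_ineq P c d /\ F = face_of P c d.

Definition vertices P : set 'cV[R]_n := [set x | is_face P [set x]].

Definition facets P : set (set 'cV[R]_n) :=
  [set F | is_face P F /\ exists2 k, has_affine_dim F k & k.+1 = n].

(* Each vertex labels exactly one row and each facet is defined by exactly one
   of the inequalities; the order of rows and columns and the scaling of the
   inequalities are left free. *)
Definition is_slack_matrix P v f (S : 'M[R]_(v, f)) : Prop :=
  exists (p : 'I_v -> 'cV[R]_n) (c : 'I_f -> 'cV[R]_n) (d : 'I_f -> R),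
    [/\ set_bij [set: 'I_v] (vertices P) p,
        forall j, valid_ineq P (c j) (d j),
        set_bij [set: 'I_f] (facets P) (fun j => face_of P (c j) (d j))
      & S = \matrix_(i < v, j < f) slack (c j) (d j) (p i)].

(* A relation, because [P] has many slack matrices; [polytope_has_psd_rank] below
   shows that some [k] always qualifies. *)
Definition is_polytope_psd_rank P (k : nat) : Prop :=
  exists v f (S : 'M[R]_(v, f)), is_slack_matrix P S /\ k = psd_rank S.

End Polytopes.

Definition is_polygon (R : realType) (P : set 'cV[R]_2) : Prop :=
  is_polytope P /\ has_affine_dim P 2.

Lemma finite_set_enum (T : choiceType) (A : set T) :
  finite_set A -> exists m (g : 'I_m -> T), set_bij [set: 'I_m] A g.
Proof.
move=> /finite_seqP[s ->]; pose t := in_tuple (undup s).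
exists (size (undup s)), (tnth t); split.
- by move=> i _ /=; rewrite -mem_undup; exact: mem_tnth.
- move=> i j _ _ /eqP; rewrite (tnth_nth (tnth t i)) (tnth_nth (tnth t i) t j).
  by rewrite nth_uniq ?undup_uniq// => /eqP/val_inj.
- move=> x; rewrite /= -mem_undup => xs.
  by have /tnthP[i ->] : x \in t by []; exists i.
Qed.

Section PsdRankExists.
Variables (R : realType) (n : nat).
Implicit Types (P F : set 'cV[R]_n) (c x : 'cV[R]_n) (d : R).

Lemma slack_conv c d x y (t : {i01 R}) :
  slack c d (conv t (x : convex_lmodType 'cV[R]_n) y) =
  t%:num * slack c d x + (1 - t%:num) * slack c d y.
Proof.
rewrite /slack; set z := conv _ _ _.
have -> : z = t%:num *: x + (1 - t%:num) *: y by [].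
rewrite mulmxDr -!scalemxAr !mxE; set X := \sum_j _; set Y := \sum_j _.
by rewrite !(mulrBr _ d) addrACA -mulrDl [X in X * d]addrC subrK mul1r opprD.
Qed.

Lemma convex_hull_convex (X : set 'cV[R]_n) :
  @convex_set R 'cV[R]_n (convex_hull X).
Proof.
move=> x y t; rewrite !inE => hx hy C [Cc XC].
have := Cc x y t; rewrite !inE; apply; [exact: hx|exact: hy].
Qed.

Lemma face_of_hull (s : seq 'cV[R]_n) c d :
  valid_ineq (convex_hull [set` s]) c d ->
  face_of (convex_hull [set` s]) c d =
  convex_hull [set` [seq x <- s | slack c d x == 0]].
Proof.
set P := convex_hull _ => Pv; set Q := convex_hull _.
have sP : [set` s] `<=` P by exact: sub_gen_smallest.
have sQ : [set` [seq x <- s | slack c d x == 0]] `<=` Q by exact: sub_gen_smallest.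
apply/seteqP; split => [x [Px]|].
- pose C := [set x | P x /\ (slack c d x = 0 -> Q x)].
  suff : P `<=` C by move=> /(_ _ Px)[].
  apply: smallest_sub => [|y ys]; last first.
    split; first exact: sP.
    by move=> /eqP y0; apply: sQ; rewrite /= mem_filter y0.
  apply/convex_setW => y z; rewrite !inE => -[Py Cy] [Pz Cz] t t0 t1.
  rewrite inE; split; first by have := convex_hull_convex t (mem_set Py) (mem_set Pz); rewrite inE.
  have t1' : 0 < 1 - t%:num by rewrite subr_gt0.
  rewrite slack_conv => /eqP; rewrite paddr_eq0; last 2 first.
  - by rewrite mulr_ge0 ?(ltW t0)//; exact: Pv.
  - by rewrite mulr_ge0 ?(ltW t1')//; exact: Pv.
  rewrite !mulf_eq0 (gt_eqF t0) (gt_eqF t1')/= => /andP[/eqP y0 /eqP z0].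
  by have := convex_hull_convex t (mem_set (Cy y0)) (mem_set (Cz z0)); rewrite inE.
- apply: smallest_sub => [x y t|x /=]; last first.
    by rewrite mem_filter => /andP[/eqP x0 xs]; split => //; exact: sP.
  rewrite !inE => -[Px x0] [Py y0]; split.
    by have := convex_hull_convex t (mem_set Px) (mem_set Py); rewrite inE.
  by rewrite slack_conv x0 y0 !mulr0 addr0.
Qed.

Lemma finite_faces P : is_polytope P -> finite_set (is_face P).
Proof.
case=> s ->; pose f (m : (size s).-tuple bool) := convex_hull [set` mask m s].
apply: (@sub_finite_set _ _ (f @` [set: _])); last exact: finite_image.
move=> F [c [d [Pv ->]]]; rewrite face_of_hull// filter_mask.
by exists [tuple of [seq slack c d x == 0 | x <- in_tuple s]].
Qed.

Lemma polytope_has_psd_rank P : is_polytope P ->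
  exists k, is_polytope_psd_rank P k.
Proof.
move=> /finite_faces fin.
have [|v [p pP]] := @finite_set_enum _ (vertices P).
  by apply: finite_preimage fin => x y _ _ /seteqP[/(_ x erefl)].
have [|f [F FP]] := @finite_set_enum _ (facets P).
  by apply: sub_finite_set fin => F [].
have /choice[cd cdP] : forall j, exists e : 'cV[R]_n * R,
    valid_ineq P e.1 e.2 /\ F j = face_of P e.1 e.2.
  move=> j; have [FP' _ _] := FP.
  by have [[c [d H]] _] := FP' j I; exists (c, d).
pose S := \matrix_(i < v, j < f) slack (cd j).1 (cd j).2 (p i).
exists (psd_rank S), v, f, S; split => //.
exists p, (fun j => (cd j).1), (fun j => (cd j).2); split => //.
  by move=> j; have [] := cdP j.
by rewrite (_ : (fun j => _) = F)//; apply/funext => j; have [_ ->] := cdP j.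
Qed.

Lemma slack_matrix_nonneg P v f (S : 'M[R]_(v, f)) :
  is_slack_matrix P S -> nonneg_mx S.
Proof.
move=> [p [c [d [[pP _ _] Pv _ ->]]]] i j; rewrite mxE; apply: Pv.
have [c' [d' [_ H]]] := pP i I.
by have [] : face_of P c' d' (p i) by rewrite -H.
Qed.
End PsdRankExists.

(* Main.v *)
(* Six vectors spanning the extreme rays of a cone in R^3 form a hexagon 1..6,
   whose chord 25 crosses the chords 14 and 36.  Hence, after scaling, the rows
   r_i of a nonnegative rank 3 matrix with six rows satisfy
   r_1 + r_4 = s r_2 + t r_5 and r_3 + r_6 = s' r_2 + t' r_5.  Geometrically,
   these two relations make the hexagon the projection of an octahedron with two
   coplanar quadruples of vertices, and such octahedra have psd rank 4: the rows
   are represented by the rank one matrices of e_1 (row 2), e_2 (row 5),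
   (sqrt s, sqrt t, +-1, 0) / 2 (rows 1, 4) and (sqrt s', sqrt t', 0, +-1) / 2
   (rows 3, 6).  If some row is a conic combination of the others, at most five
   rows matter, and either four rows remain or the chord relation between four of
   them costs 3 and the fifth row costs 1.  A matrix with more rows is cut into
   blocks of six rows. *)

Require Import Defs.
From mathcomp Require Import all_boot all_order all_algebra.
From mathcomp Require Import boolp classical_sets functions cardinality reals.
From mathcomp Require Import ring lra.

Set Implicit Arguments.
Unset Strict Implicit.
Unset Printing Implicit Defensive.

Import Order.TTheory GRing.Theory Num.Theory.

Local Open Scope classical_set_scope.
Local Open Scope ring_scope.

(** * The convex cone of rows represented by fixed psd column factors *)

Section PsdCone.
Context {R : realType}.

Lemma psd_mx0 k : psd_mx (0 : 'M[R]_k).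
Proof. by split => [|x]; rewrite ?trmx0// mulmx0 mul0mx mxE. Qed.

Lemma psd_mxD k (A B : 'M[R]_k) : psd_mx A -> psd_mx B -> psd_mx (A + B).
Proof.
move=> [At A0] [Bt B0]; split=> [|x]; first by rewrite linearD/= At Bt.
by rewrite mulmxDr mulmxDl mxE addr_ge0.
Qed.

Lemma psd_mxZ k c (A : 'M[R]_k) : 0 <= c -> psd_mx A -> psd_mx (c *: A).
Proof.
move=> c0 [At A0]; split=> [|x]; first by rewrite linearZ/= At.
by rewrite -scalemxAr -scalemxAl mxE mulr_ge0.
Qed.

Lemma psd_mx_outer k (a : 'rV[R]_k) : psd_mx (a^T *m a).
Proof.
split=> [|x]; first by rewrite trmx_mul trmxK.
rewrite mulmxA -mulmxA -trmx_mul [(a *m x)^T](_ : _ = a *m x).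
  by rewrite mxE big_ord1 -expr2 sqr_ge0.
by apply/rowP => i; rewrite !ord1 mxE.
Qed.

Lemma psd_block_diag k l (A : 'M[R]_k) (B : 'M[R]_l) :
  psd_mx A -> psd_mx B -> psd_mx (block_mx A 0 0 B).
Proof.
move=> [At A0] [Bt B0]; split=> [|x].
  by rewrite tr_block_mx At Bt !trmx0.
rewrite -[x]vsubmxK tr_col_mx mul_row_block !mulmx0 addr0 add0r mul_row_col.
by rewrite mxE addr_ge0.
Qed.

Lemma mxtrace_outer k (a : 'rV[R]_k) (B : 'M[R]_k) :
  \tr (a^T *m a *m B) = (a *m B *m a^T) 0 0.
Proof. by rewrite -mulmxA mxtrace_mulC trace_mx11. Qed.

Context {q : nat}.
Implicit Types (r : 'rV[R]_q) (S T : set 'rV[R]_q).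

(** Fixing the column factors [B] makes the representable rows a convex cone, so rescaled rows and
    conic combinations cost no extra size. *)
Definition psd_rows k (B : 'I_q -> 'M[R]_k) : set 'rV[R]_q :=
  [set r | exists A, psd_mx A /\ forall j, r 0 j = \tr (A *m B j)].

Definition psd_factorable k S : Prop :=
  exists2 B : 'I_q -> 'M[R]_k, (forall j, psd_mx (B j)) & S `<=` psd_rows B.

Lemma psd_rows0 k (B : 'I_q -> 'M[R]_k) : psd_rows B 0.
Proof.
by exists 0; split=> [|j]; [exact: psd_mx0|rewrite mul0mx linear0 mxE].
Qed.

Lemma psd_rowsD k (B : 'I_q -> 'M[R]_k) r s :
  psd_rows B r -> psd_rows B s -> psd_rows B (r + s).
Proof.
move=> [A [A0 rA]] [A' [A'0 sA]]; exists (A + A'); split; first exact: psd_mxD.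
by move=> j; rewrite mulmxDl linearD mxE/= rA sA.
Qed.

Lemma psd_rowsZ k (B : 'I_q -> 'M[R]_k) c r :
  0 <= c -> psd_rows B r -> psd_rows B (c *: r).
Proof.
move=> c0 [A [A0 rA]]; exists (c *: A); split; first exact: psd_mxZ.
by move=> j; rewrite -scalemxAl linearZ mxE/= rA.
Qed.

Lemma psd_rows_conic k (B : 'I_q -> 'M[R]_k) n (c : 'rV[R]_n)
    (X : 'M[R]_(n, q)) :
  (forall i, 0 <= c 0 i) -> (forall i, c 0 i != 0 -> psd_rows B (row i X)) ->
  psd_rows B (c *m X).
Proof.
move=> c0 XB; rewrite mulmx_sum_row; elim/big_ind: _ => //.
- exact: psd_rows0.
- by move=> x y; exact: psd_rowsD.
move=> i _; have [->|ci] := eqVneq (c 0 i) 0.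
  by rewrite scale0r; exact: psd_rows0.
by apply: psd_rowsZ => //; exact: XB.
Qed.

Lemma psd_factorable_sub k S T :
  S `<=` T -> psd_factorable k T -> psd_factorable k S.
Proof. by move=> ST [B B0 TB]; exists B => // r /ST/TB. Qed.

(** With block diagonal column factors, a row of either family uses its own block and puts zero in
    the other. *)
Lemma psd_factorableU k l S T : psd_factorable k S -> psd_factorable l T ->
  psd_factorable (k + l) (S `|` T).
Proof.
move=> [B B0 SB] [C C0 TC]; exists (fun j => block_mx (B j) 0 0 (C j)).
  by move=> j; exact: psd_block_diag.
move=> r [/SB|/TC] [A [A0 rA]]; [exists (block_mx A 0 0 0)|exists (block_mx 0 0 0 A)].
- split=> [|j]; first by apply: psd_block_diag => //; exact: psd_mx0.
  rewrite mulmx_block !(mulmx0, mul0mx, addr0, add0r) mxtrace_block.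
  by rewrite linear0 addr0 rA.
- split=> [|j]; first by apply: psd_block_diag => //; exact: psd_mx0.
  rewrite mulmx_block !(mulmx0, mul0mx, addr0, add0r) mxtrace_block.
  by rewrite linear0 add0r rA.
Qed.

Lemma psd_factorable0 : psd_factorable 0 set0.
Proof. by exists (fun=> 0) => // j; exact: psd_mx0. Qed.

Lemma psd_factorable1 r : (forall j, 0 <= r 0 j) -> psd_factorable 1 [set r].
Proof.
move=> r0; exists (fun j => (r 0 j)%:M).
  move=> j; rewrite -scalemx1; apply: psd_mxZ => //.
  by rewrite -[1%:M]mulmx1 -{1}trmx1; exact: psd_mx_outer.
move=> _ ->; exists 1%:M; split.
  by rewrite -[1%:M]mulmx1 -{1}trmx1; exact: psd_mx_outer.
by move=> j; rewrite mul1mx mxtrace_scalar.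
Qed.

Lemma psd_factorable_rows n (X : 'M[R]_(n, q)) :
  nonneg_mx X -> psd_factorable n (range (fun i => row i X)).
Proof.
elim: n X => [|n IHn] X X0.
  by apply: psd_factorable_sub psd_factorable0 => r [[]].
have fX : psd_factorable n (range (fun i => row i (row' ord0 X))).
  by apply: IHn => i j; rewrite mxE.
have X0' j : 0 <= row ord0 X 0 j by rewrite mxE.
apply: psd_factorable_sub (psd_factorableU (psd_factorable1 X0') fX).
move=> _ [i _ <-]; case: (unliftP ord0 i) => [k|] ->; last by left.
by right; exists k => //; apply/rowP => j; rewrite !mxE.
Qed.

Lemma psd_factorable_has_factorization p k (M : 'M[R]_(p, q)) :
  psd_factorable k (range (fun i => row i M)) -> has_psd_factorization M k.
Proof.
move=> [B B0 MB]; have /choice[A AP] : forall i, exists A,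
    psd_mx A /\ forall j, M i j = \tr (A *m B j).
  move=> i; have [|A [A0 rA]] := MB (row i M); first by exists i.
  by exists A; split=> // j; rewrite -rA mxE.
exists A, B; split=> // [i|i j]; first by have [] := AP i.
by have [_ ->] := AP i.
Qed.

End PsdCone.

Lemma has_psd_factorization_tr (R : realType) p q k (M : 'M[R]_(p, q)) :
  has_psd_factorization M k -> has_psd_factorization M^T k.
Proof.
move=> [A [B [A0 B0 MAB]]]; exists B, A; split=> // i j.
by rewrite mxE MAB mxtrace_mulC.
Qed.

(** * Psd factors from relations that share a chord *)

Section Chord.
Context {R : realType} {q n : nat}.
Implicit Types (r s : 'rV[R]_q) (x y : 'I_n -> 'rV[R]_q).

(** All row factors have rank one. Two coordinates, for [r] and [s], are shared by all relations;
    relation [k] adds one more, whose sign tells [x k] from [y k]. In column [j] the number [e j k],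
    between -1 and 1, records how the sum splits into its two summands. *)
Lemma psd_factorable_chord r s x y (sigma tau : 'I_n -> R) :
    (forall j, 0 <= r 0 j) -> (forall j, 0 <= s 0 j) ->
    (forall k j, 0 <= x k 0 j) -> (forall k j, 0 <= y k 0 j) ->
    (forall k, 0 <= sigma k) -> (forall k, 0 <= tau k) ->
    (forall k, x k + y k = sigma k *: r + tau k *: s) ->
  psd_factorable n.+2 ([set r; s] `|` (range x `|` range y)).
Proof.
move=> r0 s0 x0 y0 sigma0 tau0 xyrs.
pose vec (a b : R) (z : 'I_n -> R) : 'rV[R]_(1 + (1 + n)) :=
  row_mx a%:M (row_mx b%:M (\row_k z k)).
have vecM a b z a' b' z' :
    (vec a b z *m (vec a' b' z')^T) 0 0 = a * a' + b * b' + \sum_k z k * z' k.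
  rewrite /vec !tr_row_mx !mul_row_col !tr_scalar_mx -!scalar_mxM !mxE/=.
  rewrite !mulr1n addrA; congr (_ + _).
  by apply: eq_bigr => k _; rewrite !mxE.
pose sum k j := x k 0 j + y k 0 j.
(* If the sum vanishes then so do x and y, and the junk value e = 0 is harmless. *)
pose e j k := (y k 0 j - x k 0 j) / sum k j.
have sumE k j : sum k j = sigma k * r 0 j + tau k * s 0 j.
  by have := congr1 (fun v : 'rV_q => v 0 j) (xyrs k); rewrite !mxE.
have sum0 k j : 0 <= sum k j by rewrite addr_ge0.
have eM k j : e j k * sum k j = y k 0 j - x k 0 j.
  rewrite /e; have [s00|s00] := eqVneq (sum k j) 0; last by rewrite divfK.
  move: s00; rewrite /sum => /eqP; rewrite paddr_eq0// => /andP[/eqP-> /eqP->].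
  by rewrite subrr !mul0r.
have e1 k j : 0 <= (1 - e j k ^+ 2) * sum k j.
  have [s00|s00] := eqVneq (sum k j) 0; first by rewrite s00 mulr0.
  (* Multiplied by [sum k j ^+ 2], the first factor becomes (x + y)^2 - (y - x)^2 = 4xy. *)
  apply: mulr_ge0 => //; rewrite -(@pmulr_lge0 _ (sum k j ^+ 2)).
    rewrite mulrBl mul1r -exprMn eM /sum.
    have := mulr_ge0 (x0 k j) (y0 k j); lra.
  by rewrite exprn_even_gt0.
(* [e j k ^+ 2 <= 1], so that the diagonal correction [d j] is nonnegative; it
   turns the value [(1 +- e)^2 / 4] of the squared inner products into
   [(1 +- e) / 2]. *)
pose bs j := vec 1 0 (fun k => e j k * Num.sqrt (sigma k)).
pose bt j := vec 0 1 (fun k => e j k * Num.sqrt (tau k)).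
pose d j := vec 0 0 (fun k => (1 - e j k ^+ 2) * sum k j).
pose B j := r 0 j *: ((bs j)^T *m bs j) + s 0 j *: ((bt j)^T *m bt j)
  + diag_mx (d j).
have vecd a b z a' b' z' : vec a b z *m diag_mx (vec a' b' z')
    = vec (a * a') (b * b') (fun k => z k * z' k).
  rewrite mul_mx_diag /vec; apply/rowP => i; rewrite !mxE.
  case: splitP => i1 _; rewrite !mxE ?ord1 ?mulr1n//.
  by case: splitP => i2 _; rewrite !mxE ?ord1 ?mulr1n.
have trB a b z j : \tr ((vec a b z)^T *m vec a b z *m B j) =
    r 0 j * (a + \sum_k z k * (e j k * Num.sqrt (sigma k))) ^+ 2 +
    s 0 j * (b + \sum_k z k * (e j k * Num.sqrt (tau k))) ^+ 2 +
    \sum_k z k ^+ 2 * ((1 - e j k ^+ 2) * sum k j).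
  rewrite mxtrace_outer /B !mulmxDr !mulmxDl -!scalemxAr -!scalemxAl vecd.
  have outE (v w : 'rV[R]_(1 + (1 + n))) :
      (v *m (w^T *m w) *m v^T) 0 0 = (v *m w^T) 0 0 ^+ 2.
    rewrite mulmxA -mulmxA mxE big_ord1 expr2; congr (_ * _).
    have -> : w *m v^T = (v *m w^T)^T by rewrite trmx_mul trmxK.
    by rewrite mxE.
  rewrite mxE [X in X + _]mxE [X in X + _ + _]mxE [X in _ + X + _]mxE.
  rewrite !outE !vecM !mulr0 !mulr1 !mul0r add0r addr0; congr (_ + _).
  by rewrite !add0r; apply: eq_bigr => k _; rewrite mulrAC expr2.
exists B => [j|].
  apply: psd_mxD; last first.
    apply: psd_diag_mx => i; rewrite /d /vec !mxE.
    case: splitP => i1 _; rewrite !mxE ?ord1 ?mulr1n//.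
    by case: splitP => i2 _; rewrite !mxE ?ord1 ?mulr1n.
  by apply: psd_mxD; apply: psd_mxZ => //; exact: psd_mx_outer.
have half k (g : R) : let z i := (i == k)%:R * g in
    forall f : 'I_n -> R, \sum_i z i * f i = g * f k.
  move=> z f; rewrite (bigD1 k)//= big1 ?addr0 /z ?eqxx ?mul1r//.
  by move=> i /negbTE->; rewrite !mul0r.
have half2 k (g : R) : let z i := (i == k)%:R * g in
    forall f : 'I_n -> R, \sum_i z i ^+ 2 * f i = g ^+ 2 * f k.
  move=> z f; rewrite (bigD1 k)//= big1 ?addr0 /z ?eqxx ?mul1r//.
  by move=> i /negbTE->; rewrite !mul0r expr0n mul0r.
(* The sign of [g] selects the summand: -1/2 yields [x k] and 1/2 yields [y k]. *)
pose a k g := vec (Num.sqrt (sigma k) / 2) (Num.sqrt (tau k) / 2)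
  (fun i => (i == k)%:R * g).
have aB k (g : R) j : g ^+ 2 = 1 / 4 ->
    \tr ((a k g)^T *m a k g *m B j) = (1 / 2 + g * e j k) * sum k j.
  move=> g2; rewrite trB half half half2 sumE; move: (e j k) => t.
  have -> : Num.sqrt (sigma k) / 2 + g * (t * Num.sqrt (sigma k)) =
    Num.sqrt (sigma k) * (1 / 2 + g * t) by ring.
  have -> : Num.sqrt (tau k) / 2 + g * (t * Num.sqrt (tau k)) =
    Num.sqrt (tau k) * (1 / 2 + g * t) by ring.
  rewrite !exprMn !sqr_sqrtr// g2.
  have -> : (1 / 2 + g * t) ^+ 2 = 1 / 4 + g * t + g ^+ 2 * t ^+ 2 by field.
  by rewrite g2; field.
move=> _ [[->|->]|[[k _ <-]|[k _ <-]]].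
- exists ((vec 1 0 (fun=> 0))^T *m vec 1 0 (fun=> 0)).
  split=> [|j]; first exact: psd_mx_outer.
  by rewrite trB !big1 => [|i _|i _|i _]; rewrite ?expr0n ?mul0r//=; ring.
- exists ((vec 0 1 (fun=> 0))^T *m vec 0 1 (fun=> 0)).
  split=> [|j]; first exact: psd_mx_outer.
  by rewrite trB !big1 => [|i _|i _|i _]; rewrite ?expr0n ?mul0r//=; ring.
- exists ((a k (- (1 / 2)))^T *m a k (- (1 / 2))).
  split=> [|j]; first exact: psd_mx_outer.
  rewrite aB; last by field.
  by rewrite mulrDl -(mulrA _ (e j k)) eM /sum; field.
- exists ((a k (1 / 2))^T *m a k (1 / 2)).
  split=> [|j]; first exact: psd_mx_outer.
  rewrite aB; last by field.
  by rewrite mulrDl -(mulrA _ (e j k)) eM /sum; field.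
Qed.

End Chord.

(** * Linear relations among the extreme rays of a cone in three-space *)

Section Irredundant.
Context {R : realType}.

Definition conic_row n q (X : 'M[R]_(n, q)) (i : 'I_n) : Prop :=
  exists c : 'rV[R]_n,
    [/\ forall j, 0 <= c 0 j, c 0 i = 0 & row i X = c *m X].

(** For nonnegative [X], this says that the rows span distinct extreme rays of a pointed cone. *)
Definition irredundant n q (X : 'M[R]_(n, q)) : Prop :=
  forall i, ~ conic_row X i.

(** A redundant row comes for free, because [psd_rows B] is a convex cone. *)
Lemma psd_factorable_conic_row n q k (X : 'M[R]_(n.+1, q)) i : conic_row X i ->
  psd_factorable k (range (fun l => row l (row' i X))) ->
  psd_factorable k (range (fun l => row l X)).
Proof.
move=> [c [c0 ci iX]] [B B0 XB]; exists B => // _ [l _ <-].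
have rowB m : m != i -> psd_rows B (row m X).
  move=> mi; case: (unliftP i m) => [m' mm'|mm']; last by rewrite mm' eqxx in mi.
  by apply: XB; exists m' => //; apply/rowP => j; rewrite !mxE mm'.
have [->|/rowB//] := eqVneq l i.
rewrite iX; apply: psd_rows_conic => // m cm; apply: rowB.
by apply: contraNneq cm => ->; rewrite ci.
Qed.

(** A single negative coefficient would express row [i0] through the others. If there is none,
    nonnegativity of [X] makes every row with a nonzero coefficient vanish, and a zero row is a
    conic combination with zero coefficients. The sign arguments below use irredundancy only in this
    form. *)
Lemma irredundant_relation0 n q (X : 'M[R]_(n, q)) (c : 'rV[R]_n) i0 :
  nonneg_mx X -> irredundant X -> c *m X = 0 ->
  (forall i, i != i0 -> 0 <= c 0 i) -> c = 0.
Proof.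
move=> X0 irrX cX c0; case: (ltrP (c 0 i0) 0) => ci0.
  case: (irrX i0); exists (delta_mx 0 i0 - (c 0 i0)^-1 *: c); split.
  - move=> j; rewrite !mxE/= -mulNr -invrN.
    have [->|ji0] := eqVneq j i0; first by rewrite invrN mulNr mulVf ?subrr// lt_eqF.
    by rewrite add0r mulr_ge0 ?c0// invr_ge0 oppr_ge0 ltW.
  - by rewrite !mxE !eqxx mulVf ?subrr// lt_eqF.
  - by rewrite mulmxBl -scalemxAl cX scaler0 subr0 -rowE.
have {ci0}c0 i : 0 <= c 0 i by have [->|/c0] := eqVneq i i0.
apply/rowP => i; rewrite mxE; apply/eqP; apply: contraPT isT => ci.
case: (irrX i); exists 0; split => [j||]; rewrite ?mxE// mul0mx.
apply/rowP => j; rewrite !mxE; apply/eqP.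
have := congr1 (fun v : 'rV_q => v 0 j) cX; rewrite !mxE => /psumr_eq0P cXj.
have := cXj (fun l _ => mulr_ge0 (c0 l) (X0 l j)) i isT.
by move=> /eqP; rewrite mulf_eq0 (negbTE ci).
Qed.

(** Written out in coordinates so that [ring] settles its identities; [det3E] links it to [\det]. *)
Definition det3 (u v w : 'rV[R]_3) : R :=
  u 0 0 * (v 0 1 * w 0 2 - v 0 2 * w 0 1)
  - u 0 1 * (v 0 0 * w 0 2 - v 0 2 * w 0 0)
  + u 0 2 * (v 0 0 * w 0 1 - v 0 1 * w 0 0).

Lemma det3_opp u v w : det3 u w v = - det3 u v w.
Proof. by rewrite /det3; ring. Qed.

(** Cramer's dependence among four vectors of three-space, arranged as a crossing of the chords
    [u]-[w] and [v]-[z]. *)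
Lemma det3_cramer u v w z :
  det3 v w z *: u + det3 u v z *: w = det3 u w z *: v + det3 u v w *: z.
Proof.
apply/rowP => i; rewrite !mxE /det3.
have [->|->|->] : [\/ i = 0, i = 1 | i = 2].
  by case: i => [[|[|[|//]]] ?]; [constructor 1|constructor 2|constructor 3];
    exact: val_inj.
all: ring.
Qed.

Lemma det3E u v w :
  det3 u v w = \det (\matrix_(i < 3) nth 0 [:: u; v; w] i).
Proof.
have coord (z : 'rV[R]_3) : exists a b c, z = \row_i [:: a; b; c]`_i.
  exists (z 0 0), (z 0 1), (z 0 2); apply/rowP => i; rewrite !mxE.
  by case: i => [[|[|[|//]]] ?] /=; congr (z _ _); exact: val_inj.
have [u0 [u1 [u2 ->]]] := coord u; have [v0 [v1 [v2 ->]]] := coord v.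
have [w0 [w1 [w2 ->]]] := coord w; rewrite /det3.
rewrite (expand_det_row _ 0) !big_ord_recl big_ord0 /cofactor.
rewrite !(expand_det_row _ 0) !big_ord_recl !big_ord0 /cofactor !det_mx11.
by rewrite !mxE/=; ring.
Qed.

Lemma det3_eq0 u v w : det3 u v w = 0 -> exists x : 'rV[R]_3,
  x != 0 /\ x 0 0 *: u + x 0 1 *: v + x 0 2 *: w = 0.
Proof.
rewrite det3E => /eqP/det0P[x x0 xA]; exists x; split=> //.
rewrite -[RHS]xA mulmx_sum_row !big_ord_recl big_ord0 addr0 !rowK/= addrA.
by congr (_ + _ + _); congr (x _ _ *: _); exact: val_inj.
Qed.

(** Orientations are read off the rows of [U], signs off [X]; a relation among rows of [U] passes to
    [X] on multiplication by [W]. *)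
Variables (n q : nat) (U : 'M[R]_(n, 3)) (W : 'M[R]_(3, q)).
Local Notation X := (U *m W).
Hypotheses (X0 : nonneg_mx X) (irrX : irredundant X).
Local Notation D i j k := (det3 (row i U) (row j U) (row k U)).

(** General position, which makes the angular order around a row strict. *)
Lemma irredundant_det3_neq0 i j k : i != j -> i != k -> j != k -> D i j k != 0.
Proof.
move=> ij ik jk; apply/eqP => /det3_eq0[x [/eqP x0 xU]]; apply: x0.
pose c : 'rV[R]_n :=
  x 0 0 *: delta_mx 0 i + x 0 1 *: delta_mx 0 j + x 0 2 *: delta_mx 0 k.
have cX : c *m X = 0.
  by rewrite mulmxA (_ : c *m U = 0) ?mul0mx// !mulmxDl -!scalemxAl -!rowE.
have cE l : c 0 l = x 0 0 * (l == i)%:R + x 0 1 * (l == j)%:R + x 0 2 * (l == k)%:R.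
  by rewrite !mxE !eqxx.
have [ji ki kj] : [/\ j != i, k != i & k != j].
  by rewrite eq_sym ij eq_sym ik eq_sym jk.
have ci : c 0 i = x 0 0 by rewrite cE eqxx (negbTE ij) (negbTE ik)/=; ring.
have cj : c 0 j = x 0 1 by rewrite cE eqxx (negbTE ji) (negbTE jk)/=; ring.
have ck : c 0 k = x 0 2 by rewrite cE eqxx (negbTE ki) (negbTE kj)/=; ring.
suff c0 : c = 0.
  apply/rowP => l; rewrite mxE.
  have [->|->|->] : [\/ l = 0, l = 1 | l = 2].
    by case: l => [[|[|[|//]]] ?]; [constructor 1|constructor 2|constructor 3];
      exact: val_inj.
  by rewrite -ci c0 mxE.
  by rewrite -cj c0 mxE.
  by rewrite -ck c0 mxE.
have cN : - c *m X = 0 by rewrite mulNmx cX oppr0.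
(* Two of the three coefficients have the same sign, so [c] or [- c] has at most
   one negative entry. *)
have pos i0 : (forall l, l != i0 -> 0 <= c 0 l) -> c = 0.
  exact: irredundant_relation0.
have neg i0 : (forall l, l != i0 -> c 0 l <= 0) -> c = 0.
  move=> H; apply/eqP; rewrite -oppr_eq0; apply/eqP.
  by apply: (irredundant_relation0 (i0 := i0)) => // l /H cl0; rewrite mxE oppr_ge0.
have cl l : l != i -> l != j -> l != k -> c 0 l = 0.
  by move=> /negbTE li /negbTE lj /negbTE lk; rewrite cE li lj lk/=; ring.
have pos2 a b m : (forall l, l != a -> l != b -> l != m -> c 0 l = 0) ->
    0 <= c 0 a -> 0 <= c 0 b -> c = 0.
  move=> out a0 b0; apply: (pos m) => l lm.
  have [->//|la] := eqVneq l a; have [->//|lb] := eqVneq l b.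
  by rewrite out.
have neg2 a b m : (forall l, l != a -> l != b -> l != m -> c 0 l = 0) ->
    c 0 a <= 0 -> c 0 b <= 0 -> c = 0.
  move=> out a0 b0; apply: (neg m) => l lm.
  have [->//|la] := eqVneq l a; have [->//|lb] := eqVneq l b.
  by rewrite out.
have clikj l : l != i -> l != k -> l != j -> c 0 l = 0 by move=> *; exact: cl.
have cljki l : l != j -> l != k -> l != i -> c 0 l = 0 by move=> *; exact: cl.
case: (lerP 0 (c 0 i)) => [|/ltW] i0; case: (lerP 0 (c 0 j)) => [|/ltW] j0;
  case: (lerP 0 (c 0 k)) => [|/ltW] k0;
  first [exact: pos2 cl i0 j0|exact: pos2 clikj i0 k0|exact: pos2 cljki j0 k0
        |exact: neg2 cl i0 j0|exact: neg2 clikj i0 k0|exact: neg2 cljki j0 k0].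
Qed.

(* Seen from an extreme ray [i], the other rays are linearly ordered by angle:
   otherwise [i] would lie in the cone spanned by [j], [k] and [l]. *)
Lemma irredundant_det3_trans i j k l : k != i ->
  0 <= D i j k -> 0 <= D i k l -> 0 <= D i j l.
Proof.
move=> ki Djk Dkl; rewrite leNgt; apply/negP => Djl.
(* The relation of [det3_cramer], with signs chosen so that only the coefficient at [i] can be
   negative. *)
pose c : 'rV[R]_n :=
  D i k l *: delta_mx 0 j + D i j k *: delta_mx 0 l
  - D i j l *: delta_mx 0 k - D j k l *: delta_mx 0 i.
have cX : c *m X = 0.
  rewrite mulmxA (_ : c *m U = 0) ?mul0mx// !mulmxBl !mulmxDl -!scalemxAl -!rowE.
  rewrite -addrA -opprD [X in _ - X]addrC.
  by rewrite (det3_cramer (row i U) (row j U) (row k U) (row l U)) subrr.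
have c0 : c = 0.
  apply: (irredundant_relation0 (i0 := i)) => // m /negbTE mi.
  rewrite !mxE !eqxx mi/= mulr0 subr0 -mulNr !addr_ge0// mulr_ge0//.
  by rewrite oppr_ge0 ltW.
(* If [j] or [l] coincides with [k], it only adds a nonnegative term. *)
have : 0 < c 0 k.
  rewrite !mxE !eqxx (negbTE ki)/= mulr0 subr0 mulr1 ltr_wpDl ?oppr_gt0//.
  by rewrite addr_ge0// mulr_ge0.
by rewrite c0 mxE ltxx.
Qed.

(** The coefficients come from [det3_cramer], and the hypotheses make those of [a] and [d] positive.
    If the one of [i] or of [c] were negative, moving all terms to one side would leave at most one
    negative coefficient, against [irredundant_relation0]. *)
Lemma irredundant_crossing i a c d : c != i ->
  0 < D i a c -> 0 < D i c d ->
  exists alpha delta sigma tau, [/\ 0 < alpha, 0 < delta, 0 <= sigma, 0 <= tau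
    & alpha *: row a X + delta *: row d X = sigma *: row i X + tau *: row c X].
Proof.
move=> ci Dac Dcd; exists (D i c d), (D i a c), (- D c a d), (D i a d).
have eqX : D i c d *: row a X + D i a c *: row d X =
    - D c a d *: row i X + D i a d *: row c X.
  have := det3_cramer (row i U) (row c U) (row a U) (row d U).
  rewrite (det3_opp _ (row a U) (row c U)) => H.
  rewrite !row_mul !scalemxAl -!mulmxDl; congr (_ *m W).
  apply/eqP; rewrite -subr_eq0; move/eqP: H; rewrite -subr_eq0 => /eqP <-.
  by apply/eqP/rowP => l; move: (D _ _ _) (D _ _ _) => *; rewrite !mxE; ring.
pose v : 'rV[R]_n := D i c d *: delta_mx 0 a + D i a c *: delta_mx 0 d
  - (- D c a d *: delta_mx 0 i + D i a d *: delta_mx 0 c).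
have vX : v *m X = 0.
  by rewrite mulmxBl !mulmxDl -!scalemxAl -!rowE eqX subrr.
have vE l : v 0 l = D i c d * (l == a)%:R + D i a c * (l == d)%:R
    + D c a d * (l == i)%:R - D i a d * (l == c)%:R.
  by rewrite !mxE !eqxx/=; ring.
have v_ge0 l : l != c -> l != i -> 0 <= v 0 l.
  move=> /negbTE lc /negbTE li; rewrite vE lc li !mulr0 subr0 addr0.
  by rewrite addr_ge0// mulr_ge0// ltW.
have ad_ge0 l : 0 <= D i c d * (l == a)%:R + D i a c * (l == d)%:R.
  by rewrite addr_ge0// mulr_ge0// ltW.
split=> //.
- rewrite oppr_ge0 leNgt; apply/negP => Dcad.
  have vi : 0 < v 0 i.
    by rewrite vE eqxx [i == c]eq_sym (negbTE ci) mulr0 subr0 mulr1 ltr_wpDl.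
  have v0 : v = 0.
    apply: (irredundant_relation0 (i0 := c)) => // l lc.
    by have [->|li] := eqVneq l i; [exact: ltW|exact: v_ge0].
  by rewrite v0 mxE ltxx in vi.
- rewrite leNgt; apply/negP => Diad.
  have vc : 0 < v 0 c.
    by rewrite vE eqxx (negbTE ci) mulr0 addr0 mulr1 ltr_wpDl// oppr_gt0.
  have v0 : v = 0.
    apply: (irredundant_relation0 (i0 := i)) => // l li.
    by have [->|lc] := eqVneq l c; [exact: ltW|exact: v_ge0].
  by rewrite v0 mxE ltxx in vc.
Qed.

End Irredundant.

(** * Sorting the rays by angle and covering the rows by chords *)

Section Hexagon.
Context {R : realType} {q : nat}.
Implicit Types (W : 'M[R]_(3, q)).

(** The orientation seen from row 0 is total by antisymmetry of [det3] and transitive by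
    [irredundant_det3_trans], so the other rows can be sorted; nonvanishing determinants make the
    inequalities strict. *)
Lemma irredundant_sort n (U : 'M[R]_(n.+1, 3)) W :
    nonneg_mx (U *m W) -> irredundant (U *m W) ->
  exists s : seq 'I_n,
    [/\ size s = n, uniq s, forall i, i \in s
      & pairwise (fun j k => 0 < det3 (row 0 U) (row (lift 0 j) U)
                                     (row (lift 0 k) U)) s].
Proof.
move=> X0 irrX.
pose D j k := det3 (row 0 U) (row (lift 0 j) U) (row (lift 0 k) U).
pose le j k := 0 <= D j k.
have le_total : total le.
  by move=> j k; rewrite /le [D k j]det3_opp oppr_ge0 le_total.
have le_trans : transitive le.
  move=> k j l; apply: irredundant_det3_trans X0 irrX _ _ _ _ _.
  by rewrite eq_sym neq_lift.
have us : uniq (sort le (enum 'I_n)) by rewrite sort_uniq enum_uniq.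
exists (sort le (enum 'I_n)); split => //.
- by rewrite size_sort size_enum_ord.
- by move=> i; rewrite mem_sort mem_enum.
- have : pairwise (fun j k => le j k && (j != k)) (sort le (enum 'I_n)).
    by rewrite pairwise_relI -sorted_pairwise// sort_sorted// -uniq_pairwise.
  apply: sub_pairwise => j k /andP[jk njk]; rewrite lt_neqAle [X in _ && X]jk andbT.
  rewrite eq_sym; apply: (irredundant_det3_neq0 X0 irrX); rewrite ?neq_lift//.
Qed.

(** Positive rescaling of [x k] and [y k] reduces to [psd_factorable_chord], and the cone
    [psd_rows B] allows it to be undone. *)
Lemma psd_factorable_crossings n (r s : 'rV[R]_q) (x y : 'I_n -> 'rV[R]_q) :
    (forall j, 0 <= r 0 j) -> (forall j, 0 <= s 0 j) ->
    (forall k j, 0 <= x k 0 j) -> (forall k j, 0 <= y k 0 j) ->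
    (forall k, exists alpha delta sigma tau : R,
      [/\ 0 < alpha, 0 < delta, 0 <= sigma, 0 <= tau
        & alpha *: x k + delta *: y k = sigma *: r + tau *: s]) ->
  psd_factorable n.+2 ([set r; s] `|` (range x `|` range y)).
Proof.
move=> r0 s0 x0 y0 /choice[alpha /choice[delta /choice[sigma /choice[tau H]]]].
have [alpha0 delta0] : (forall k, 0 < alpha k) /\ (forall k, 0 < delta k).
  by split=> k; have [] := H k.
have scale_ge0 (c : 'I_n -> R) (z : 'I_n -> 'rV[R]_q) : (forall k, 0 < c k) ->
    (forall k j, 0 <= z k 0 j) -> forall k j, 0 <= (c k *: z k) 0 j.
  by move=> c0 z0 k j; rewrite mxE mulr_ge0// ltW.
have [|||B B0 SB] := psd_factorable_chord (sigma := sigma) (tau := tau)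
    r0 s0 (scale_ge0 _ _ alpha0 x0) (scale_ge0 _ _ delta0 y0).
- by move=> k; have [] := H k.
- by move=> k; have [] := H k.
- by move=> k; have [] := H k.
exists B => // z.
have unscale c (v : 'rV[R]_q) : 0 < c -> psd_rows B (c *: v) -> psd_rows B v.
  move=> c0 /(psd_rowsZ (ltW (_ : 0 < c^-1))); rewrite invr_gt0 => /(_ c0).
  by rewrite scalerA mulVf ?gt_eqF// scale1r.
move=> [zrs|[[k _ <-]|[k _ <-]]].
- by apply: SB; left.
- by apply: (unscale _ _ (alpha0 k)); apply: SB; right; left; exists k.
- by apply: (unscale _ _ (delta0 k)); apply: SB; right; right; exists k.
Qed.

Lemma psd_factorable5 (U : 'M[R]_(5, 3)) W : nonneg_mx (U *m W) ->
  psd_factorable 4 (range (fun i => row i (U *m W))).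
Proof.
move=> X0; have [[i iX]|irrX] := pselect (exists i, conic_row (U *m W) i).
  apply: (psd_factorable_conic_row iX); apply: psd_factorable_rows => j k.
  by rewrite mxE.
have {}irrX : irredundant (U *m W) by move=> i iX; apply: irrX; exists i.
have X0' i j : 0 <= row i (U *m W) 0 j by rewrite mxE.
have [s [+ us ins +]] := irredundant_sort X0 irrX.
case: s us ins => [|a [|b [|c [|d []]]]]// _ ins _ /=.
rewrite !andbT => /and3P[/and3P[ab _ _] /andP[bc _] _].
(* As [b] lies between [a] and [c], the chord from 0 to [b] crosses the chord from [a] to [c]; [d]
   is the fifth row. *)
have := irredundant_crossing X0 irrX _ ab bc.
rewrite eq_sym neq_lift => /(_ isT) cross.
have fX := psd_factorable_crossings (X0' 0) (X0' (lift 0 b))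
  (fun=> X0' (lift 0 a)) (fun=> X0' (lift 0 c)) (fun _ : 'I_1 => cross).
apply: psd_factorable_sub (psd_factorableU fX (psd_factorable1 (X0' (lift 0 d)))).
move=> _ [i _ <-]; case: (unliftP 0 i) => [k|] ->; last by left; left; left.
have := ins k; rewrite !inE => /or4P[]/eqP->.
- by left; right; left; exists 0.
- by left; left; right.
- by left; right; right; exists 0.
- by right.
Qed.

(* Third in the order around the row [0], [c] leaves two rays on each side of the
   chord from [0] to [c]. *)
Lemma psd_factorable6 (U : 'M[R]_(6, 3)) W : nonneg_mx (U *m W) ->
  psd_factorable 4 (range (fun i => row i (U *m W))).
Proof.
move=> X0; have [[i iX]|irrX] := pselect (exists i, conic_row (U *m W) i).
  apply: (psd_factorable_conic_row iX).
  have rowX : row' i (U *m W) = row' i U *m W.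
    by apply/matrixP => k l; rewrite !mxE; apply: eq_bigr => m _; rewrite mxE.
  by rewrite rowX; apply: psd_factorable5 => j k; rewrite -rowX mxE.
have {}irrX : irredundant (U *m W) by move=> i iX; apply: irrX; exists i.
have X0' i j : 0 <= row i (U *m W) 0 j by rewrite mxE.
have [s [+ us ins +]] := irredundant_sort X0 irrX.
case: s us ins => [|a [|b [|c [|d [|e []]]]]]// _ ins _ /=.
rewrite !andbT => /and4P[/and4P[_ ac _ _] /and3P[bc _ _] /andP[cd ce] _].
have c0 : lift 0 c != 0 :> 'I_6 by rewrite eq_sym neq_lift.
have ad := irredundant_crossing X0 irrX c0 ac cd.
have be := irredundant_crossing X0 irrX c0 bc ce.
pose x (k : 'I_2) := row (lift 0 (if k == 0 then a else b)) (U *m W).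
pose y (k : 'I_2) := row (lift 0 (if k == 0 then d else e)) (U *m W).
have fX := psd_factorable_crossings (X0' 0) (X0' (lift 0 c))
  (fun k : 'I_2 => X0' (lift 0 (if k == 0 then a else b)))
  (fun k : 'I_2 => X0' (lift 0 (if k == 0 then d else e))).
apply: psd_factorable_sub (fX _) => [_ [i _ <-]|k]; last by case: (k == 0).
case: (unliftP 0 i) => [k|] ->; last by left; left.
have := ins k; rewrite !inE => /orP[/eqP->|/or4P[]/eqP->].
- by right; left; exists 0.
- by right; left; exists 1.
- by left; right.
- by right; right; exists 0.
- by right; right; exists 1.
Qed.

Lemma psd_factorable_rank3 m p (U : 'M[R]_(p, 3)) W : nonneg_mx (U *m W) ->
  (p <= 6 * m)%N -> psd_factorable (4 * m) (range (fun i => row i (U *m W))).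
Proof.
move=> X0 pm.
(* Restricting to the rows before [6 * m] allows induction on [m] with [p] fixed. *)
suff : psd_factorable (4 * m)
    [set row i (U *m W) | i in [set i : 'I_p | (i < 6 * m)%N]].
  apply: psd_factorable_sub => _ [i _ <-]; exists i => //=.
  exact: leq_trans pm.
elim: m {pm} => [|m IHm].
  rewrite muln0; apply: psd_factorable_sub psd_factorable0 => r [i /=].
  by rewrite muln0.
(* The last block may run past row [p]; it is padded with zero rows, which keep the product
   nonnegative. *)
pose V := \matrix_(k < 6) oapp (fun i => row i U) 0 (insub (6 * m + k)%N : option 'I_p).
have V0 : nonneg_mx (V *m W).
  move=> k j; have -> : (V *m W) k j = row k (V *m W) 0 j by rewrite [RHS]mxE.
  rewrite row_mul rowK; case: insub => [i|] /=.
    by rewrite -row_mul mxE.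
  by rewrite mul0mx mxE.
rewrite mulnS addnC; apply: psd_factorable_sub (psd_factorableU IHm (psd_factorable6 V0)).
move=> _ [i /= im <-]; have [lim|mi] := ltnP i (6 * m); first by left; exists i.
have im6 : (i - 6 * m < 6)%N by rewrite ltn_subLR// addnC -mulnS.
right; exists (Ordinal im6) => //; rewrite !row_mul rowK/= subnKC//.
by rewrite valK.
Qed.

End Hexagon.

(** * The bound for matrices and for polygons *)

Lemma psd_rank_le_ceil (R : realType) p q n (U : 'M[R]_(p, 3)) (W : 'M[R]_(3, q)) :
    nonneg_mx (U *m W) -> n = p \/ n = q ->
  (psd_rank (U *m W))%:Z <= 4 * Num.ceil (n%:R / 6 : R).
Proof.
move=> X0 npq; have c0 : 0 <= Num.ceil (n%:R / 6 : R).
  by rewrite ceil_ge0 (lt_le_trans (ltrN10 _))// divr_ge0.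
(* Being nonnegative, the ceiling is a natural number [m], the number of blocks. *)
rewrite -(gez0_abs c0); set m := absz _.
have nm : (n <= 6 * m)%N.
  rewrite -(ler_nat R) natrM -ler_pdivrMl// mulrC.
  by rewrite (le_trans (ceil_ge _))// -[in leLHS](gez0_abs c0).
rewrite -PoszM lez_nat; apply: (psd_rankP X0).2.
case: npq => npq; rewrite npq in nm.
  exact/psd_factorable_has_factorization/psd_factorable_rank3.
rewrite -[U *m W]trmxK; apply: has_psd_factorization_tr; rewrite trmx_mul.
apply/psd_factorable_has_factorization/psd_factorable_rank3 => // i j.
by rewrite -trmx_mul mxE.
Qed.

Theorem theorem3p7 (R : realType) :
  (forall (p q : nat) (M : 'M[R]_(p, q)),
      nonneg_mx M -> \rank M = 3%N ->
      (psd_rank M)%:Z <= 4 * Num.ceil ((minn p q)%:R / 6 : R)) /\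
  (forall (P : set 'cV[R]_2) (v k : nat),
      is_polygon P -> (vertices P #= `I_v)%card -> is_polytope_psd_rank P k ->
      k%:Z <= 4 * Num.ceil (v%:R / 6 : R)).
Proof.
split=> [p q M M0 rkM|P v k _ Pv [v' [f [S [PS ->]]]]].
  (* The rank factorization of [M] has inner dimension 3. *)
  move: M0; rewrite -(mulmx_base M).
  move: (col_base M) (row_base M); rewrite rkM => U W X0.
  apply: psd_rank_le_ceil => //; rewrite /minn; case: ltnP => _; [by left|by right].
have := slack_matrix_nonneg PS; have [p [c [d [pP _ _ SE]]]] := PS.
(* The rows of [S] are labelled bijectively by the vertices. *)
have -> : v = v'.
  apply/card_eq_II; rewrite -(card_eql Pv).
  have [pV pinj psurj] := pP.
  have -> : vertices P = p @` [set: 'I_v'].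
    apply/seteqP; split=> [x /psurj//|_ [i _ <-]]; exact: pV.
  rewrite card_eq_sym.
  have -> : `I_v' = (@nat_of_ord v') @` [set: 'I_v'].
    by apply/seteqP; split=> [i /= iv|_ [i _ <-] /=]; [exists (Ordinal iv)|].
  apply: (card_eq_trans (inj_card_eq _)); first by move=> i j _ _; exact: val_inj.
  by rewrite card_eq_sym; apply: inj_card_eq.
(* In homogeneous coordinates the slack is the product of (1, p_i) and (d_j, -c_j), so [S] factors
   through dimension 3. *)
pose U := \matrix_(i < v', l < 3) nth 0 [:: 1; p i 0 0; p i 1 0] l.
pose W := \matrix_(l < 3, j < f) nth 0 [:: d j; - c j 0 0; - c j 1 0] l.
have -> : S = U *m W.
  apply/matrixP => i j; rewrite SE !mxE /slack mxE !big_ord_recl !big_ord0 !mxE/=.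
  have -> : lift ord0 ord0 = 1 :> 'I_2 by exact: val_inj.
  by ring.
by move=> X0; apply: psd_rank_le_ceil => //; left.
Qed.
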